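(* Let $d$ be a nonnegative integer and let $G$ be an abelian group of order $2^{2d+2}$, rank at least $d+1$, and exponent $2^e$, where $2\le e\le\frac{d+3}{2}$. Then $G$ contains a reduced linking system of difference sets of size $2^{\left\lfloor\frac{d+1}{e-1}\right\rfloor}-1$, that is, a reduced $\left(2^{2d+2},\,2^d(2^{d+1}-1),\,2^d(2^d-1),\,2^{2d};\,2^{\left\lfloor\frac{d+1}{e-1}\right\rfloor}-1\right)$-linking system of difference sets.
   Context: Groups are written multiplicatively. For a group $G$ of order $v$, a subset $D\subseteq G$ with $k$ elements is a $(v,k,\lambda,n)$-difference set in $G$ if the multiset $\{d_1d_2^{-1} : d_1,d_2\in D,\ d_1\neq d_2\}$ contains every non-identity element of $G$ exactly $\lambda$ times, where $n:=k-\lambda$. A subset $S$ of $G$ is identified with the element $\sum_{s\in S}s$ of the group ring $\mathbb{Z}[G]$, and $S^{(-1)}:=\sum_{s\in S}s^{-1}$. For $\ell\ge 2$, a collection $\{D_1,\dots,D_\ell\}$ of size $\ell$ of $(v,k,\lambda,n)$-difference sets in $G$ is a reduced $(v,k,\lambda,n;\ell)$-linking system of difference sets in $G$ of size $\ell$ if there are integers $\mu,\nu$ such that for all distinct $i,j$ there is some $(v,k,\lambda,n)$-difference set $D(i,j)$ in $G$ (not necessarily one of the $D_r$) with $D_iD_j^{(-1)}=(\mu-\nu)D(i,j)+\nu G$ in $\mathbb{Z}[G]$. The rank of an abelian 2-group isomorphic to $\mathbb{Z}_{2^{a_1}}\times\cdots\times\mathbb{Z}_{2^{a_t}}$ with all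 $a_i\ge 1$ is $t$. The exponent of $G$ is the smallest positive integer $\alpha$ with $g^\alpha=1_G$ for all $g\in G$. *)

(* Defs.v *)
From HB Require Import structures.
From mathcomp Require Import all_boot all_order all_algebra.
From mathcomp Require Import all_fingroup all_solvable.

Set Implicit Arguments.
Unset Strict Implicit.
Unset Printing Implicit Defensive.

Import GRing.Theory.
Local Open Scope ring_scope.

(* The integral group ring of the ambient group gT, with f : zgring gT standing
   for the formal sum of the f x . x. For G : {group gT}, Z[G] is the subring of
   the elements supported on G. *)
Definition zgring (gT : finGroupType) : Type := {ffun gT -> int}.

HB.instance Definition _ (gT : finGroupType) := GRing.Zmodule.on (zgring gT).

Section GroupRing.
Variable gT : finGroupType.
Implicit Types (f g h : zgring gT) (x y z : gT).

Definition zgbasis x : zgring gT := [ffun y => (y == x)%:R].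

Definition zgmul f g : zgring gT :=
  [ffun z => \sum_x f x * g (x^-1 * z)%g].

Fact zgmulA : associative zgmul.
Proof.
move=> f g h; apply/ffunP=> z; rewrite !ffunE.
under eq_bigr => x _ do rewrite ffunE mulr_sumr.
under [RHS]eq_bigr => y _ do rewrite ffunE mulr_suml.
rewrite [RHS]exchange_big /=; apply: eq_bigr => x _.
rewrite [RHS](reindex_inj (mulgI x)) /=; apply: eq_bigr => y _.
by rewrite mulKg invMg !mulgA mulrA.
Qed.

Fact zgmul1f : left_id (zgbasis 1%g) zgmul.
Proof.
move=> f; apply/ffunP=> z; rewrite ffunE (bigD1 1%g) //= big1 => [|x nx1].
  by rewrite ffunE eqxx mul1r invg1 mul1g addr0.
by rewrite ffunE (negPf nx1) mul0r.
Qed.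

Fact zgmulf1 : right_id (zgbasis 1%g) zgmul.
Proof.
move=> f; apply/ffunP=> z; rewrite ffunE (bigD1 z) //= big1 => [|x nxz].
  by rewrite ffunE mulVg eqxx mulr1 addr0.
by rewrite ffunE -eq_mulVg1 (negPf nxz) mulr0.
Qed.

Fact zgmulDl : left_distributive zgmul +%R.
Proof.
move=> f g h; apply/ffunP=> z; rewrite !ffunE -big_split /=.
by apply: eq_bigr => x _; rewrite ffunE mulrDl.
Qed.

Fact zgmulDr : right_distributive zgmul +%R.
Proof.
move=> f g h; apply/ffunP=> z; rewrite !ffunE -big_split /=.
by apply: eq_bigr => x _; rewrite ffunE mulrDr.
Qed.

Fact zgone_neq0 : zgbasis 1%g != 0.
Proof. by apply/eqP=> /ffunP/(_ 1%g); rewrite !ffunE eqxx. Qed.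

HB.instance Definition _ := GRing.Zmodule_isNzRing.Build (zgring gT)
  zgmulA zgmul1f zgmulf1 zgmulDl zgmulDr zgone_neq0.

Lemma zgbasisM x y : zgbasis x * zgbasis y = zgbasis (x * y)%g.
Proof.
apply/ffunP=> z; rewrite !ffunE (bigD1 x) //= big1 => [|u nux].
  by rewrite !ffunE eqxx mul1r addr0 -(inj_eq (mulgI x)) mulKVg.
by rewrite ffunE (negPf nux) mul0r.
Qed.

Definition zgset (S : {set gT}) : zgring gT := \sum_(s in S) zgbasis s.

Definition zgsetV (S : {set gT}) : zgring gT := \sum_(s in S) zgbasis s^-1%g.

End GroupRing.

Definition difference_set (gT : finGroupType) (G : {group gT})
    (v k lambda n : nat) (D : {set gT}) : Prop :=
  [/\ #|G| = v, D \subset G, #|D| = k, n%:Z = k%:Z - lambda%:Z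
    & forall g, g \in G -> g != 1%g ->
        #|[set p in setX D D | (p.1 != p.2) && (p.1 * p.2^-1 == g)%g]|
        = lambda].

Definition reduced_linking_system (gT : finGroupType) (G : {group gT})
    (v k lambda n l : nat) (L : {set {set gT}}) : Prop :=
  [/\ (2 <= l)%N, #|L| = l,
      forall D, D \in L -> difference_set G v k lambda n D
    & exists mu nu : int, forall Di Dj : {set gT},
        Di \in L -> Dj \in L -> Di != Dj ->
        exists2 D : {set gT}, difference_set G v k lambda n D
          & zgset Di * zgsetV Dj = zgset D *~ (mu - nu) + zgset G *~ nu].

(* MathComp's rank 'r(G) is the number of nontrivial cyclic factors in a
   decomposition of an abelian 2-group. *)
Lemma rank_2group_dprod (gT : finGroupType) (G : {group gT}) (b : seq gT) :
  (2.-group G)%g -> abelian G -> (\big[dprod/1]_(x <- b) <[x]>)%g = G -> 1%g \notin b ->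
  'r(G)%g = size b.
Proof.
move=> pG cGG defG ntb.
rewrite -size_abelian_type //.
by rewrite (perm_size (abelian_type_pgroup pG defG ntb)) size_map.
Qed.

(* Main.v *)
Require Import Defs.
From mathcomp Require Import all_boot all_order all_algebra.
From mathcomp Require Import all_fingroup all_solvable all_field.
From mathcomp Require Import zify.

(** Write [n = d + 1]. The group [G] has order [2 ^ (2 * n)], and since its rank
is at least [n] it contains an elementary abelian subgroup [E] of order [2 ^ n].
Let [chi_c], with [c] in an index set [C] of size [2 ^ n], be the characters of
[E], all with values [1] and [-1], seen as elements of the group ring. They are
orthogonal idempotents up to scale: [chi_c * chi_c'] is [0] if [c != c'] and
[2 ^ n * chi_c] otherwise, and their sum is [2 ^ n] times the identity.
For [g : C -> G] put [B(g) = \sum_c g_c * chi_c]. As [G] is abelian,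

  [B(g) * B(h)^(-1) = 2 ^ n * B(g * h^-1)]    (lemma [spreadM]),

where the product and inverse on the right are taken pointwise. If [g] meets
each coset of [E] once, then [B(g)] takes only the values [1] and [-1] on [G],
and the case [h = g] of the identity says that the set [D(g)] where [B(g)] is
[-1] is a difference set of Menon (Hadamard) type. If moreover [h] and
[g * h^-1] also meet each coset once, then, because [B(g) = G - 2 * D(g)], the
identity turns into the linking relation between [D(g)] and [D(h)], with
[D(g * h^-1)] as the third difference set ([menon_linking]).

Hence it is enough to have many maps [C -> G / E] which are bijective and whose
pairwise quotients are bijective. These are the rows of a difference matrix over
[G / E] after division by one of the rows, so [k.+1] rows of such a matrix give
a linking system of size [k] ([linking_system_of_difference_matrix]).

Difference matrices are built as follows. An elementary abelian [p]-group is the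
additive group of a finite field, and the multiplication table of the field is a
difference matrix with as many rows as the group has elements. Difference
matrices over a subgroup and over the quotient by it, with the same number of
rows, combine into one over the whole group. So an abelian [p]-group of exponent
dividing [p ^ m] and order at least [p ^ (m * r)] has a difference matrix with
[p ^ r] rows ([difference_matrix_abelian_pgroup]): it has a series of length [m]
with elementary abelian factors of order at least [p ^ r].

Finally [E] can be chosen to contain all the [2 ^ (e - 1)]-th powers of elements
of [G], so that [G / E] has exponent dividing [2 ^ (e - 1)]. Its order is
[2 ^ (d + 1)], which yields [2 ^ ((d + 1) %/ (e - 1))] rows. *)

Set Implicit Arguments.
Unset Strict Implicit.
Unset Printing Implicit Defensive.

Import GRing.Theory Num.Theory.

(** * Difference matrices over abelian p-groups *)

Section DifferenceMatrix.
Local Open Scope group_scope.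

(** The columns are indexed by an arbitrary type of the right size, because the
matrices below come with columns indexed by a field or by pairs of columns. *)
Definition has_difference_matrix (gT : finGroupType) (Q : {group gT}) k : Prop :=
  exists (C : finType) (phi : 'I_k -> C -> gT),
    [/\ #|C| = #|Q|, forall i c, phi i c \in Q
      & forall i j, i != j -> injective (fun c => phi i c * (phi j c)^-1)].

Lemma difference_matrix_trivial (gT : finGroupType) (Q : {group gT}) k :
  #|Q| = 1%N -> has_difference_matrix Q k.
Proof.
move=> Q1; exists unit, (fun _ _ => 1); split=> [|i c|i j _ [] []] //.
by rewrite card_unit Q1.
Qed.

(** The matrix is the multiplication table of the field of order [#|E|], and the
difference of two rows [a] and [b] is the injective map [c |-> (a - b) * c]. *)
Lemma difference_matrix_abelem p (gT : finGroupType) (E : {group gT}) k :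
  p.-abelem E -> E :!=: 1 -> k <= #|E| -> has_difference_matrix E k.
Proof.
move=> abelE ntE le_k; have pE := abelem_pgroup abelE.
have [p_pr _ [n cardE]] := pgroup_pdiv pE ntE.
have [F charF cardF] := pPrimePowerField p_pr (ltn0Sn n).
have [|f injf imf] := @isogP _ _ [set: F]%G E _.
  by rewrite (isog_abelem_card _ (fin_ring_pchar_abelem charF)) abelE /= cardsT cardF cardE.
have le_kF : k <= #|F| by rewrite cardF -cardE.
pose a (i : 'I_k) : F := enum_val (widen_ord le_kF i).
have inj_a : injective a.
  by move=> i j /enum_val_inj/(congr1 val)/= /val_inj.
exists F, (fun i c => f (a i * c)%R); split=> [|i c|i j nij c c'].
- by rewrite cardF cardE.
- by rewrite -imf mem_morphim ?inE.
- rewrite -!morphV ?inE // -!morphM ?inE // => /(injmP injf).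
  rewrite !inE => /(_ isT isT).
  change ((a i * c - a j * c = a i * c' - a j * c')%R -> c = c').
  rewrite -!mulrBl; apply: mulfI.
  by rewrite subr_eq0 (inj_eq inj_a).
Qed.

Lemma lift_quotient (gT : finGroupType) (Q N : {group gT}) (I J : Type)
    (beta : I -> J -> coset_of N) :
  (forall i j, beta i j \in Q / N) ->
  exists b : I -> J -> gT, forall i j, b i j \in Q /\ coset N (b i j) = beta i j.
Proof.
move=> betaQ; pose P i j x := (x \in Q) && (coset N x == beta i j).
have exP i j : exists x, P i j x.
  by have /morphimP[x _ Qx beta_x] := betaQ i j; exists x; rewrite /P Qx beta_x /=.
exists (fun i j => xchoose (exP i j)) => i j.
by have /andP[? /eqP] := xchooseP (exP i j).
Qed.

(** Columns are pairs of columns and entries are the products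
[b_ i c.1 * alpha i c.2], where [b_] lifts the matrix over [Q / N]. The quotient
of two rows determines [c.1] through its image in [Q / N], and then [c.2]. *)
Lemma difference_matrix_extension (gT : finGroupType) (Q N : {group gT}) k :
  abelian Q -> N \subset Q -> has_difference_matrix N k ->
  has_difference_matrix (Q / N) k -> has_difference_matrix Q k.
Proof.
move=> cQQ sNQ [A [alpha [cardA alphaN inj_alpha]]] [B [beta [cardB betaQ inj_beta]]].
have nNQ : Q \subset 'N(N) by rewrite (sub_abelian_norm cQQ).
have [b_ bP] := lift_quotient betaQ.
have bQ i c : b_ i c \in Q by case: (bP i c).
have aQ i c : alpha i c \in Q by rewrite (subsetP sNQ).
exists (B * A)%type, (fun i c => b_ i c.1 * alpha i c.2); split=> [|i c|i j nij].
- by rewrite card_prod cardA cardB card_quotient // mulnC Lagrange.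
- by rewrite groupM.
have regroup c : b_ i c.1 * alpha i c.2 * (b_ j c.1 * alpha j c.2)^-1
    = (b_ i c.1 * (b_ j c.1)^-1) * (alpha i c.2 * (alpha j c.2)^-1).
  have comm x y : x \in Q -> y \in Q -> x * y = y * x.
    by move=> Qx Qy; apply: (centsP cQQ).
  rewrite invMg -!mulgA; congr (_ * _).
  by rewrite mulgA comm ?groupM ?groupV.
move=> [b a] [b' a']; rewrite !regroup /= => eq_ba.
have bb' : b = b'.
  apply: (inj_beta _ _ nij) => /=; have := congr1 (coset N) eq_ba.
  have nN x : x \in Q -> x \in 'N(N) by move/(subsetP nNQ).
  have cosb c : coset N (b_ i c * (b_ j c)^-1) = beta i c * (beta j c)^-1.
    by rewrite -(bP i c).2 -(bP j c).2 morphM ?groupV ?nN // morphV ?nN.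
  have cosMr x y : x \in Q -> y \in N -> coset N (x * y) = coset N x.
    move=> Qx Ny; rewrite (morphM _ (nN x Qx) (nN y _)) /= ?(subsetP sNQ) //.
    by rewrite (coset_id Ny) mulg1.
  have bbQ c : b_ i c * (b_ j c)^-1 \in Q by rewrite groupM ?groupV.
  have aaN c : alpha i c * (alpha j c)^-1 \in N by rewrite groupM ?groupV.
  by rewrite (cosMr _ _ (bbQ b) (aaN a)) (cosMr _ _ (bbQ b') (aaN a')) !cosb.
by rewrite bb' in eq_ba *; move/mulgI: eq_ba => /(inj_alpha _ _ nij) ->.
Qed.

Section AbelianPGroup.
Variable p : nat.
Hypothesis p_pr : prime p.

Lemma exponent_Mho1 (gT : finGroupType) (Q : {group gT}) m :
  p.-group Q -> abelian Q -> exponent Q %| p ^ m.+1 ->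
  exponent 'Mho^1(Q) %| p ^ m.
Proof.
move=> pQ cQQ expQ; apply/exponentP=> y.
rewrite (MhoEabelian _ pQ cQQ) => /imsetP[x Qx ->].
by rewrite -expgM expn1 -expnS (exponentP expQ).
Qed.

Lemma Mho_Mho1 (gT : finGroupType) (Q : {group gT}) m :
  p.-group Q -> abelian Q -> 'Mho^m('Mho^1(Q)) = 'Mho^m.+1(Q).
Proof.
move=> pQ cQQ; have sMQ := Mho_sub 1 Q.
rewrite (MhoEabelian _ (pgroupS sMQ pQ) (abelianS sMQ cQQ)).
rewrite /= !(MhoEabelian _ pQ cQQ); apply/setP=> y; apply/idP/idP=> /imsetP[x Qx ->].
  have /imsetP[z Qz ->] := Qx.
  by rewrite -expgM expn1 -expnS; apply: imset_f.
apply/imsetP; exists (x ^+ (p ^ 1)); first exact: imset_f.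
by rewrite -expgM expn1 -expnS.
Qed.

(** The index of ['Mho^i.+1(Q)] in ['Mho^i(Q)] is the order of
['Ohm_1('Mho^i(Q))], so these indices decrease with [i]. The order of [Q] is
their product: this lemma bounds them by the first one, and [card_Mho_le] below
bounds them from below by the last one. *)
Lemma card_le_Ohm1 (gT : finGroupType) m (Q : {group gT}) :
  p.-group Q -> abelian Q -> exponent Q %| p ^ m -> #|Q| <= #|'Ohm_1(Q)| ^ m.
Proof.
elim: m Q => [|m IHm] Q pQ cQQ expQ.
  rewrite expn0 in expQ *; rewrite -trivg_exponent in expQ.
  by rewrite (eqP expQ) cards1.
rewrite -(mul_card_Ohm_Mho_abelian 1 cQQ) expnS leq_mul2l; apply/orP; right.
have sMQ := Mho_sub 1 Q.
have expM := exponent_Mho1 pQ cQQ expQ.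
apply: leq_trans (IHm _ (pgroupS sMQ pQ) (abelianS sMQ cQQ) expM) _.
have: #|'Ohm_1('Mho^1(Q))| <= #|'Ohm_1(Q)| by rewrite subset_leq_card ?OhmS.
by case: m {IHm expQ expM} => // m; rewrite leq_exp2r.
Qed.

Lemma Mho_sub_Ohm1 (gT : finGroupType) m (Q : {group gT}) :
  p.-group Q -> abelian Q -> exponent Q %| p ^ m.+1 -> 'Mho^m(Q) \subset 'Ohm_1(Q).
Proof.
move=> pQ cQQ expQ; rewrite (MhoEabelian _ pQ cQQ).
rewrite (OhmEabelian pQ (abelianS (Ohm_sub 1 Q) cQQ)).
apply/subsetP=> _ /imsetP[x Qx ->].
by rewrite !inE groupX //= -expgM expn1 -expnSr (exponentP expQ).
Qed.

Lemma card_Mho_le (gT : finGroupType) m (Q : {group gT}) :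
  p.-group Q -> abelian Q -> exponent Q %| p ^ m.+1 -> #|'Mho^m(Q)| ^ m.+1 <= #|Q|.
Proof.
elim: m Q => [|m IHm] Q pQ cQQ expQ; first by rewrite Mho0 expn1.
have sMQ := Mho_sub 1 Q.
rewrite -(mul_card_Ohm_Mho_abelian 1 cQQ) expnS leq_mul //.
  by rewrite subset_leq_card ?Mho_sub_Ohm1.
rewrite -Mho_Mho1 //.
exact: IHm (pgroupS sMQ pQ) (abelianS sMQ cQQ) (exponent_Mho1 pQ cQQ expQ).
Qed.

(** Any [E] between ['Mho^m(Q)] and ['Ohm_1(Q)] is elementary abelian and has a
quotient of exponent dividing [p ^ m]; here its order is prescribed. *)
Lemma abelem_intermediate (gT : finGroupType) m n (Q : {group gT}) :
  p.-group Q -> abelian Q -> exponent Q %| p ^ m.+1 ->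
  #|'Mho^m(Q)| <= p ^ n <= #|'Ohm_1(Q)| ->
  exists E : {group gT}, [/\ E \subset Q, p.-abelem E, #|E| = (p ^ n)%N
    & exponent (Q / E) %| p ^ m].
Proof.
move=> pQ cQQ expQ /andP[leMn lenO].
have sMO := Mho_sub_Ohm1 pQ cQQ expQ.
have abelO := Ohm1_abelem pQ cQQ; have pO := abelem_pgroup abelO.
(* [E] is the product of ['Mho^m(Q)] and a subgroup [R] of a complement. *)
have [C defO] := abelem_split_dprod abelO sMO.
have [_ _ _ tiMC] := dprodP defO; have cardO := dprod_card defO.
have sCO : C \subset 'Ohm_1(Q) by case/dprodP: defO => _ <- _ _; apply: mulG_subr.
have pM := pgroupS sMO pO; have pC := pgroupS sCO pO.
have [R [sRC _ cardR]] : exists R : {group gT},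
    [/\ R \subset C, R <| C & #|R| = p ^ (n - logn p #|'Mho^m(Q)|)]%N.
  apply: (normal_pgroup pC (normal_refl C)).
  rewrite leq_subLR -lognM ?cardG_gt0 // cardO -(leq_exp2l _ _ (prime_gt1 p_pr)).
  by rewrite -(card_pgroup pO).
have sRO := subset_trans sRC sCO.
have cardMR : #|'Mho^m(Q) * R| = (p ^ n)%N.
  rewrite TI_cardMg; last by apply/trivgP; rewrite -tiMC setIS.
  rewrite cardR {1}(card_pgroup pM) -expnD subnKC //.
  by rewrite -(leq_exp2l _ _ (prime_gt1 p_pr)) -(card_pgroup pM).
have cMR : R \subset 'C('Mho^m(Q)).
  by rewrite (centsS (Mho_sub m Q)) // (subset_trans sRO) // (subset_trans (Ohm_sub 1 Q)).
pose E := ('Mho^m(Q) <*> R)%G.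
have sEO : E \subset 'Ohm_1(Q) by rewrite join_subG sMO.
exists E; split.
- exact: subset_trans sEO (Ohm_sub 1 Q).
- exact: abelemS sEO abelO.
- by rewrite /= cent_joinEr.
apply/exponentP=> _ /morphimP[x nEx Qx ->].
rewrite -morphX //= coset_id //; apply: (subsetP (joing_subl _ _)).
by rewrite (MhoEabelian _ pQ cQQ); apply: imset_f.
Qed.

(** Induction on [m], splitting off a subgroup [E] between ['Mho^m(Q)] and
['Ohm_1(Q)]. Its order has to be at least [p ^ r], for the matrix over [E], and
at least [#|'Mho^m(Q)|]; the larger of these two still leaves [Q / E] big enough
for the induction, since [#|'Mho^m(Q)| ^ m.+1 <= #|Q|]. *)
Lemma difference_matrix_abelian_pgroup m r (gT : finGroupType) (Q : {group gT}) :
  0 < r -> p.-group Q -> abelian Q -> exponent Q %| p ^ m -> p ^ (m * r) <= #|Q| ->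
  has_difference_matrix Q (p ^ r).
Proof.
move=> r_gt0; have p_gt1 := prime_gt1 p_pr.
elim: m gT Q => [|m IHm] gT Q pQ cQQ expQ leQ.
  apply: difference_matrix_trivial.
  by rewrite expn0 -trivg_exponent in expQ; rewrite (eqP expQ) cards1.
have sMO := Mho_sub_Ohm1 pQ cQQ expQ.
have pM := pgroupS (Mho_sub m Q) pQ; have pO := pgroupS (Ohm_sub 1 Q) pQ.
have := card_Mho_le pQ cQQ expQ; have := card_le_Ohm1 pQ cQQ expQ.
have := subset_leq_card sMO; move: leQ.
move: (card_pgroup pQ) (card_pgroup pM) (card_pgroup pO).
move: (logn p _) (logn p _) (logn p _) => t u q cardQ cardM cardO.
rewrite cardQ cardM cardO -!expnM !leq_exp2l // => le_q le_ut le_qt le_uq.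
have le_rt : r <= t.
  by rewrite -(leq_pmul2r (ltn0Sn m)) (leq_trans _ le_qt) // mulnC.
have [|E [sEQ abelE cardE expQE]] := @abelem_intermediate gT m (maxn r u) Q pQ cQQ expQ.
  rewrite cardM cardO !leq_exp2l // leq_maxr.
  by rewrite geq_max le_rt.
apply: (difference_matrix_extension cQQ sEQ).
  apply: (difference_matrix_abelem abelE).
    rewrite -cardG_gt1 cardE -(expn0 p) ltn_exp2l //.
    by rewrite (leq_trans r_gt0) // leq_maxl.
  by rewrite cardE leq_exp2l // leq_maxl.
apply: IHm => //; first exact: quotient_pgroup.
  exact: quotient_abelian.
have nEQ : Q \subset 'N(E) by rewrite (sub_abelian_norm cQQ).
rewrite -(leq_pmul2l (cardG_gt0 E)) card_quotient // Lagrange // cardE.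
rewrite cardQ -expnD leq_exp2l //.
rewrite addnC; case: (leqP u r) => [le_ur | /ltnW le_ru].
  by rewrite addnC -mulSn.
rewrite addnC (leq_trans _ le_uq) // mulnS leq_add2l mulnC.
by rewrite leq_mul2r le_ru orbT.
Qed.
End AbelianPGroup.
End DifferenceMatrix.

(** * The integral group ring *)

Section GroupRingFacts.
Local Open Scope ring_scope.
Variable gT : finGroupType.
Implicit Types (f g : zgring gT) (x y : gT) (S : {set gT}).

(** The involution written [f^(-1)] in the literature on difference sets. *)
Definition zginv f : zgring gT := [ffun y => f (y^-1)%g].

Lemma zgmulE f g y : (f * g) y = \sum_x f x * g (x^-1 * y)%g.
Proof. by rewrite ffunE. Qed.

Lemma zgbasisE x y : zgbasis x y = (y == x)%:R.
Proof. by rewrite ffunE. Qed.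

Lemma zgaddE f g y : (f + g) y = f y + g y.
Proof. by rewrite ffunE. Qed.

Lemma zgoppE f y : (- f) y = - f y.
Proof. by rewrite ffunE. Qed.

Lemma zgmulnE f n y : (f *+ n) y = f y *+ n.
Proof. exact: ffunMnE. Qed.

Definition zglinE := (zgaddE, zgoppE, zgmulnE).

Lemma zgmulzE f (n : int) y : (f *~ n) y = f y * n.
Proof.
case: n => n; first by rewrite -pmulrn ffunMnE -mulr_natr natz.
by rewrite NegzE mulrNz ffunE -pmulrn ffunMnE -mulr_natr mulrN natz.
Qed.

Lemma zgbasisMl x f y : (zgbasis x * f) y = f (x^-1 * y)%g.
Proof.
rewrite zgmulE (bigD1 x) //= big1 => [|z nzx].
  by rewrite ffunE eqxx mul1r addr0.
by rewrite ffunE (negPf nzx) mul0r.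
Qed.

Lemma zgbasisMr x f y : (f * zgbasis x) y = f (y * x^-1)%g.
Proof.
rewrite zgmulE (bigD1 (y * x^-1)%g) //= big1 => [|z nzx].
  by rewrite ffunE invMg invgK mulgKV eqxx mulr1 addr0.
rewrite ffunE (can2_eq (mulKVg _) (mulKg _)) -(can2_eq (mulgKV _) (mulgK _)) eq_sym.
by rewrite (negPf nzx) mulr0.
Qed.

Lemma zginv_basis x : zginv (zgbasis x) = zgbasis (x^-1)%g.
Proof. by apply/ffunP=> y; rewrite !ffunE (can2_eq invgK invgK). Qed.

Lemma zginvM f g : zginv (f * g) = zginv g * zginv f.
Proof.
apply/ffunP=> y; rewrite !ffunE (reindex_inj (mulgI y^-1%g)) /=.
apply: eq_bigr => x _.
by rewrite !ffunE !invMg !invgK mulgK mulrC.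
Qed.

Lemma zginv_sum (I : Type) (r : seq I) (P : pred I) (F : I -> zgring gT) :
  zginv (\sum_(i <- r | P i) F i) = \sum_(i <- r | P i) zginv (F i).
Proof.
apply/ffunP=> y; rewrite ffunE !sum_ffunE; apply: eq_bigr => i _.
by rewrite ffunE.
Qed.

Lemma zginvB f g : zginv (f - g) = zginv f - zginv g.
Proof. by apply/ffunP=> y; rewrite !ffunE. Qed.

Lemma zginvMn f n : zginv (f *+ n) = zginv f *+ n.
Proof. by apply/ffunP=> y; rewrite zgmulnE !ffunE zgmulnE. Qed.

Lemma zgsetE S y : zgset S y = (y \in S)%:R.
Proof.
rewrite /zgset sum_ffunE; have [Sy | nSy] := boolP (y \in S).
  rewrite (bigD1 y) //= ffunE eqxx big1 // => x /andP[_ nxy].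
  by rewrite ffunE eq_sym (negPf nxy).
by rewrite big1 // => x Sx; rewrite ffunE eq_sym (negPf (memPn nSy _ Sx)).
Qed.

Lemma zgsetVE S : zgsetV S = zginv (zgset S).
Proof.
by rewrite zginv_sum; apply: eq_bigr => x _; rewrite zginv_basis.
Qed.

End GroupRingFacts.

(** * Menon difference sets as sign functions *)

Section Menon.
Local Open Scope ring_scope.
Variables (gT : finGroupType) (G : {group gT}).
Implicit Types (f g : zgring gT).

Definition signs_on f :=
  forall y, if y \in G then f y = 1 \/ f y = -1 else f y = 0.

Definition neg_set f : {set gT} := [set y | f y == -1].

Lemma neg_set_sub f : signs_on f -> neg_set f \subset G.
Proof.
move=> sf; apply/subsetP=> y; rewrite inE; have := sf y.
by case: ifP => // _ ->.
Qed.

Lemma zgset_neg f : signs_on f -> zgset G - f = zgset (neg_set f) *+ 2.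
Proof.
move=> sf; apply/ffunP=> y; rewrite !zglinE !zgsetE inE.
by have := sf y; case: ifP => _; [case|] => ->.
Qed.

Lemma sum_zgset (S : {set gT}) : \sum_y zgset S y = #|S|%:Z :> int.
Proof.
rewrite -sum1_card -natz natr_sum [RHS]big_mkcond /=.
by apply: eq_bigr => y _; rewrite zgsetE; case: ifP.
Qed.

Lemma mul_zgset f : signs_on f -> f * zgset G = zgset G *~ (\sum_y f y).
Proof.
move=> sf; apply/ffunP=> y; rewrite zgmulE zgmulzE mulr_sumr.
apply: eq_bigr => x _; rewrite !zgsetE.
have := sf x; case: ifP => [Gx _ | _ ->]; last by rewrite mul0r mulr0.
by rewrite groupMl ?groupV // mulrC.
Qed.

Lemma zginv_zgset : zginv (zgset G) = zgset G.
Proof. by apply/ffunP=> y; rewrite ffunE !zgsetE groupV. Qed.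

Lemma zgset_mul_inv f : signs_on f -> zgset G * zginv f = zgset G *~ (\sum_y f y).
Proof.
move=> sf; rewrite -{1}zginv_zgset -zginvM mul_zgset //.
by apply/ffunP=> y; rewrite ffunE !zgmulzE !zgsetE groupV.
Qed.

Lemma signs_on_zgset : signs_on (zgset G).
Proof. by move=> y; rewrite zgsetE; case: (y \in G) => //; left. Qed.

(** Multiply out [(G - f) * (G - g)^(-1)], in which [G - f] is twice the set
where [f] is negative. *)
Lemma neg_set_mul f g : signs_on f -> signs_on g ->
  zgset (neg_set f) * zgsetV (neg_set g) *+ 4 =
  zgset G *~ (#|G|%:Z - \sum_y f y - \sum_y g y) + f * zginv g.
Proof.
move=> sf sg; have -> : 4%N = (2 * 2)%N by [].
rewrite mulrnA -mulrnAl -mulrnAr zgsetVE.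
have -> : zginv (zgset (neg_set g)) *+ 2 = zgset G - zginv g.
  by rewrite -{1}zginv_zgset -zginvB zgset_neg //; rewrite zginvMn.
rewrite -zgset_neg // mulrBl !mulrBr zgset_mul_inv //.
rewrite !mul_zgset //; last exact: signs_on_zgset.
rewrite sum_zgset !mulrzBr opprB addrA addrAC -!addrA; congr (_ + _).
by rewrite addrC addrA addrAC addrC.
Qed.

Lemma card_neg_set f : signs_on f -> (#|neg_set f|%:Z) *+ 2 = #|G|%:Z - \sum_y f y.
Proof.
move=> sf; rewrite -!sum_zgset -sumrMnl -sumrB; apply: eq_bigr => y _.
by have /ffunP/(_ y) := zgset_neg sf; rewrite !zglinE => ->.
Qed.

(** The counts in the definition of a difference set are the coefficients of
[D * D^(-1)] away from the identity. *)
Lemma count_quotients (D : {set gT}) x : x != 1%g ->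
  #|[set p in setX D D | (p.1 != p.2) && (p.1 * p.2^-1 == x)%g]|%:Z
  = (zgset D * zgsetV D) x.
Proof.
move=> nx1; rewrite zgmulE zgsetVE.
have -> : [set p in setX D D | (p.1 != p.2) && (p.1 * p.2^-1 == x)%g]
    = [set (y, x^-1 * y)%g | y in [set y in D | (x^-1 * y)%g \in D]].
  apply/setP=> -[y z]; rewrite !inE /=; apply/idP/imsetP.
    case/andP=> /andP[Dy Dz] /andP[_ /eqP Dx].
    by exists y; rewrite -Dx ?inE invMg invgK mulgKV ?Dy.
  case=> y'; rewrite !inE => /andP[Dy Dxy] [-> ->]; rewrite Dy Dxy /=.
  rewrite invMg invgK mulKVg eqxx andbT.
  by rewrite -{1}[y']mul1g (inj_eq (mulIg y')) eq_sym invg_eq1.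
rewrite card_imset => [|y z [->]//]; rewrite -sum1_card -natz natr_sum [LHS]big_mkcond /=.
apply: eq_bigr => y _; rewrite ffunE !zgsetE inE invMg invgK.
by case: (y \in D); rewrite ?mul0r ?mul1r //=; case: ifP.
Qed.

(** The last hypothesis says that [f (x * y^-1)] are the entries of a Hadamard
matrix. By it and [neg_set_mul], all the coefficients of [D * D^(-1)] away from
the identity are equal to [(4 * u ^ 2 - 2 * (2 * u)) / 4]. *)
Lemma menon_difference_set f (u : nat) :
  signs_on f -> (0 < u)%N -> #|G| = (4 * u ^ 2)%N -> \sum_y f y = (2 * u)%:Z ->
  f * zginv f = zgbasis 1%g *~ #|G| ->
  difference_set G (4 * u ^ 2) (u * (2 * u - 1)) (u * (u - 1)) (u ^ 2) (neg_set f).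
Proof.
move=> sf u_gt0 cardG sumf ff; split=> //; first exact: neg_set_sub.
- by have := card_neg_set sf; rewrite cardG sumf; nia.
- by nia.
move=> x Gx nx1; apply/eqP; rewrite -eqz_nat count_quotients //; apply/eqP.
have /ffunP/(_ x) := neg_set_mul sf sf.
rewrite zgmulnE ff zgaddE !zgmulzE zgsetE Gx zgbasisE (negPf nx1) cardG sumf.
nia.
Qed.

(** By [neg_set_mul], four times the left-hand side is
[(4 * u ^ 2 - 4 * u) * G + 2 * u * (G - 2 * H)], where [H] is the negative set
of [h]. Evenness of [u] is what allows the division by four. *)
Lemma menon_linking f g h (b : nat) : let u := (2 * b)%N in
  signs_on f -> signs_on g -> signs_on h -> #|G| = (4 * u ^ 2)%N ->
  \sum_y f y = (2 * u)%:Z -> \sum_y g y = (2 * u)%:Z ->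
  f * zginv g = h *~ (2 * u)%:Z ->
  zgset (neg_set f) * zgsetV (neg_set g) =
  zgset (neg_set h) *~ (- u%:Z) + zgset G *~ (u%:Z ^+ 2 - b%:Z).
Proof.
move=> u sf sg sh cardG sumf sumg fg; have := neg_set_mul sf sg.
move: (zgset _ * zgsetV _) => p pE; apply/ffunP=> x.
have /ffunP/(_ x) := pE; have /ffunP/(_ x) := zgset_neg sh.
rewrite fg cardG sumf sumg !(zglinE, zgmulzE).
move: (zgset G x) (zgset _ x) (h x) (p x) => gx dx hx px; rewrite /u; nia.
Qed.

End Menon.

(** * Characters of elementary abelian 2-groups *)

Section Characters.
Local Open Scope ring_scope.

Definition sgF2 (a : 'F_2) : int := (-1) ^+ a.

Lemma sgF2D a b : sgF2 (a + b) = sgF2 a * sgF2 b.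
Proof. by move: a b => [[|[|[]]] ?] // [[|[|[]]] ?]. Qed.

(** If [u i 0 = 1], translating [v] by the [i]-th basis vector changes the sign
of every term. *)
Lemma sum_sgF2 n (u : 'cV['F_2]_n) :
  \sum_(v : 'rV['F_2]_n) sgF2 ((v *m u) 0 0) = ((2 ^ n) * (u == 0))%:Z.
Proof.
have [->|nzu] := eqVneq u 0.
  under eq_bigr => v _ do rewrite mulmx0 mxE.
  by rewrite sumr_const card_mx card_Fp // mul1n muln1 natz.
have [i nzui] : exists i, u i 0 != 0.
  case: (pickP (fun i => u i 0 != 0)) => [i nzui | u0]; first by exists i.
  case/eqP: nzu; apply/matrixP=> i j; rewrite ord1 mxE; apply/eqP.
  exact: negbFE (u0 i).
have ui1 : u i 0 = 1 by move: (u i 0) nzui => [[|[|[]]] ?] // _; apply: val_inj.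
set S := \sum_v _; suff : S = - S by rewrite muln0; move: S => S; lia.
rewrite {1}/S (reindex_inj (addrI (delta_mx 0 i))) /S -sumrN /=; apply: eq_bigr => v _.
by rewrite mulmxDl mxE sgF2D -rowE mxE ui1 mulN1r.
Qed.

Definition sign_characters (gT : finGroupType) (E : {group gT}) (C : finType)
    (chi : C -> gT -> int) : Prop :=
  [/\ forall c x, x \in E -> chi c x = 1 \/ chi c x = -1,
      forall c x y, x \in E -> y \in E -> chi c (x * y)%g = chi c x * chi c y,
      forall c c', \sum_(x in E) chi c x * chi c' x = (#|E| * (c == c'))%:Z
    & forall x, x \in E -> \sum_c chi c x = (#|E| * (x == 1%g))%:Z].

(** Identify both [E] and the index set with the row vectors over ['F_2]; then
[chi c x] is the sign of the dot product of [c] and [x], and both orthogonality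
relations are instances of [sum_sgF2]. *)
Lemma exists_sign_characters (gT : finGroupType) (E : {group gT}) (C : finType) :
  2.-abelem%g E -> #|C| = #|E| -> exists chi : C -> gT -> int, sign_characters E chi.
Proof.
move=> abelE cardC; have [n cardE] := p_natP (abelem_pgroup abelE).
pose V := 'rV['F_2]_n.
have cardV : #|{: V}| = #|E| by rewrite card_mx card_Fp // mul1n cardE.
have [|f injf imf] := @isogP _ _ E [set: V]%G _.
  rewrite (isog_abelem_card _ abelE) /= fin_lmod_pchar_abelem ?pchar_Fp //=.
  by rewrite cardsT cardV.
have cardCV : #|C| = #|{: V}| by rewrite cardC.
pose b c : V := enum_val (cast_ord cardCV (enum_rank c)).
have bij_b : bijective b.
  exists (fun v => enum_val (cast_ord (esym cardCV) (enum_rank v))) => x.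
    by rewrite /b enum_valK cast_ordK enum_rankK.
  by rewrite /b enum_valK cast_ordKV enum_rankK.
have inj_b := bij_inj bij_b.
have fD x y : x \in E -> y \in E -> f (x * y)%g = f x + f y.
  exact: morphM.
have sum_f (F : V -> int) : \sum_(x in E) F (f x) = \sum_v F v.
  rewrite -(big_imset F (injmP injf)); apply: eq_bigl => v.
  by rewrite -morphimEdom imf !inE.
have F2_double (a : 'F_2) : a + a = 0.
  by apply/val_inj; move: a => [[|[|[]]] ?].
exists (fun c x => sgF2 ((f x *m (b c)^T) 0 0)); split.
- move=> c x _; rewrite /sgF2 -signr_odd.
  by case: odd; [right | left].
- by move=> c x y Ex Ey; rewrite fD // mulmxDl mxE sgF2D.
- move=> c c'.
  transitivity (\sum_(v : V) sgF2 ((v *m (b c + b c')^T) 0 0)).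
    rewrite -sum_f; apply: eq_bigr => x Ex.
    by rewrite -sgF2D linearD mulmxDr [in RHS]mxE.
  rewrite sum_sgF2 cardE; congr (_ * _)%N%:Z; congr (nat_of_bool _).
  apply/eqP/eqP=> [bb0 | ->].
    apply: inj_b; apply: (@addIr _ (b c')).
    rewrite -[LHS]trmxK bb0 trmx0; apply/matrixP=> i j.
    by rewrite !mxE F2_double.
  by apply/matrixP=> i j; rewrite !mxE F2_double.
move=> x Ex; transitivity (\sum_(v : V) sgF2 ((v *m (f x)^T) 0 0)).
  rewrite [RHS](reindex b) /=; last exact: onW_bij.
  apply: eq_bigr => c _; congr sgF2; rewrite !mxE; apply: eq_bigr => i _.
  by rewrite !mxE mulrC.
rewrite sum_sgF2 cardE; congr (_ * _)%N%:Z; congr (nat_of_bool _).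
by rewrite -(morph_injm_eq1 injf) // -[RHS](inj_eq trmx_inj) trmx0.
Qed.
End Characters.

(** * Spreading characters over the cosets *)

Section Spread.
Local Open Scope ring_scope.
Variables (gT : finGroupType) (G E : {group gT}).
Variables (C : finType) (chi : C -> gT -> int).
Hypotheses (cGG : abelian G) (sEG : E \subset G).
Hypothesis chiP : sign_characters E chi.
Implicit Types (g h : C -> gT) (c : C).

Definition char_sum c : zgring gT := [ffun x => if x \in E then chi c x else 0].

Definition spread g : zgring gT := \sum_c zgbasis (g c) * char_sum c.

Definition transversal_map g :=
  (forall c, g c \in G) /\ injective (fun c => coset E (g c)).

Lemma char_sumE c x : char_sum c x = if x \in E then chi c x else 0.
Proof. by rewrite ffunE. Qed.

Lemma chiV c x : x \in E -> chi c x^-1%g = chi c x.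
Proof.
move=> Ex; case: chiP => chi_pm chiM _ _.
have chi1 : chi c 1%g = 1.
  by have := chiM c 1%g 1%g (group1 E) (group1 E); rewrite mulg1;
    case: (chi_pm c 1%g (group1 E)) => ->.
have := chiM c x x^-1%g Ex; rewrite groupV mulgV chi1 => /(_ Ex).
case: (chi_pm c x Ex) => ->; rewrite ?mul1r // mulN1r => ->.
by rewrite opprK.
Qed.

Lemma char_sumV c : zginv (char_sum c) = char_sum c.
Proof.
by apply/ffunP=> x; rewrite ffunE !char_sumE groupV; case: ifP => // Ex; rewrite chiV.
Qed.

Lemma char_sumM c c' : char_sum c * char_sum c' = char_sum c' *~ (#|E| * (c == c'))%:Z.
Proof.
case: chiP => _ chiM chi_orth _; apply/ffunP=> z.
rewrite zgmulE zgmulzE -chi_orth mulr_sumr [RHS]big_mkcond /=; apply: eq_bigr => x _.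
rewrite !char_sumE; case: ifP => Ex; last by rewrite mul0r.
rewrite groupMl ?groupV //; case: ifP => Ez; last by rewrite mulr0 mul0r.
by rewrite chiM ?groupV // chiV // mulrA mulrC.
Qed.

Lemma char_sum_comm c x : x \in G -> zgbasis x * char_sum c = char_sum c * zgbasis x.
Proof.
move=> Gx; apply/ffunP=> y; rewrite zgbasisMl zgbasisMr.
have [Gy | nGy] := boolP (y \in G).
  by rewrite -[(y * _)%g](centsP cGG) ?groupV.
rewrite !char_sumE; case: ifP => [/(subsetP sEG) | _].
  by rewrite groupMl ?groupV // (negPf nGy).
by case: ifP => // /(subsetP sEG); rewrite groupMr ?groupV // (negPf nGy).
Qed.

(** The products of different characters vanish, so only the diagonal terms of
the double sum survive. *)
Lemma spreadM g h : (forall c, g c \in G) -> (forall c, h c \in G) ->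
  spread g * zginv (spread h) = spread (fun c => g c * (h c)^-1)%g *~ #|E|.
Proof.
move=> gG hG; rewrite /spread zginv_sum mulr_suml mulrz_suml.
apply: eq_bigr => c _; rewrite mulr_sumr (bigD1 c) //= big1 => [|c' ncc'].
  rewrite addr0 zginvM zginv_basis char_sumV mulrA -(mulrA (zgbasis _)) char_sumM eqxx muln1.
  by rewrite -mulrA mulrzAl -char_sum_comm ?groupV // mulrzAr mulrA zgbasisM.
rewrite zginvM zginv_basis char_sumV mulrA -(mulrA (zgbasis _)) char_sumM.
by rewrite eq_sym (negPf ncc') muln0 mulr0z mulr0 mul0r.
Qed.

Lemma spreadE g y : spread g y = \sum_c char_sum c ((g c)^-1 * y)%g.
Proof. by rewrite /spread sum_ffunE; apply: eq_bigr => c _; rewrite zgbasisMl. Qed.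

Lemma sum_char_sum x : \sum_c char_sum c x = (#|E| * (x == 1%g))%:Z.
Proof.
case: chiP => _ _ _ chi_reg; have [Ex | nEx] := boolP (x \in E).
  by rewrite -chi_reg //; apply: eq_bigr => c _; rewrite char_sumE Ex.
rewrite big1 => [|c _]; last by rewrite char_sumE (negPf nEx).
by case: eqP nEx => [-> | _]; rewrite ?group1 ?muln0.
Qed.

Lemma spread1 : spread (fun=> 1%g) = zgbasis 1%g *~ #|E|.
Proof.
apply/ffunP=> y; rewrite spreadE zgmulzE zgbasisE.
under eq_bigr => c _ do rewrite invg1 mul1g.
by rewrite sum_char_sum PoszM mulrC natz.
Qed.

Lemma spread_norm g : (forall c, g c \in G) ->
  spread g * zginv (spread g) = zgbasis 1%g *~ (#|E| ^ 2)%N.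
Proof.
move=> gG; rewrite spreadM //.
have -> : spread (fun c => g c * (g c)^-1)%g = spread (fun=> 1%g).
  by apply: eq_bigr => c _; rewrite mulgV.
by rewrite spread1 -mulrzA -mulnn PoszM.
Qed.

(** Translations do not change the total, which is thus that of the sum of all
characters, [#|E|] times the identity. *)
Lemma sum_spread g : \sum_y spread g y = #|E|%:Z.
Proof.
under eq_bigr => y _ do rewrite spreadE.
rewrite exchange_big /=; transitivity (\sum_c \sum_y char_sum c y).
  by apply: eq_bigr => c _; rewrite [RHS](reindex_inj (mulgI (g c)^-1%g)).
rewrite exchange_big (bigD1 1%g) //= sum_char_sum eqxx muln1 big1 ?addr0 // => x nx1.
by rewrite sum_char_sum (negPf nx1) muln0.
Qed.

(** Exactly one term of the sum is nonzero at a given point of [G]: the one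
whose index [c] gives the coset of that point. *)
Lemma spread_signs g : #|C| = #|G : E|%g -> transversal_map g -> signs_on G (spread g).
Proof.
move=> cardC [gG inj_g] y; rewrite spreadE; case: ifP => Gy; last first.
  rewrite big1 // => c _; rewrite char_sumE ifN //; apply: contraFN Gy => /(subsetP sEG).
  by rewrite groupMl ?groupV.
have nEG : G \subset 'N(E)%g by rewrite (sub_abelian_norm cGG).
have NG x : x \in G -> x \in 'N(E)%g by move/(subsetP nEG).
have [c coset_c] : exists c, coset E (g c) = coset E y.
  have im_g : [set coset E (g c) | c in C] = (G / E)%g.
    apply/eqP; rewrite eqEcard (card_imset _ inj_g) card_quotient // cardC leqnn andbT.
    by apply/subsetP=> _ /imsetP[c _ ->]; apply: mem_quotient.
  by have := mem_quotient E Gy; rewrite -im_g => /imsetP[c _ ->]; exists c.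
have in_E c' : ((g c')^-1 * y \in E)%g = (c' == c).
  have cosM : coset E ((g c')^-1 * y) = ((coset E (g c'))^-1 * coset E (g c))%g.
    by rewrite coset_c morphM ?morphV ?groupV ?NG.
  rewrite -(inj_eq inj_g) /= eq_mulVg1 -cosM; apply/idP/eqP => [/coset_id // | ].
  by apply: coset_idr; rewrite NG ?groupM ?groupV.
rewrite (bigD1 c) //= big1 => [|c' ncc']; last first.
  by rewrite char_sumE in_E (negPf ncc').
rewrite addr0 char_sumE in_E eqxx; case: chiP => chi_pm _ _ _.
by apply: chi_pm; rewrite in_E.
Qed.

End Spread.

(** * Linking systems *)

(** One row of the matrix is spent as a denominator: dividing the other rows by
it makes them bijective and keeps their quotients. The resulting difference sets
are distinct, as otherwise [B(h)], for [h] the quotient of two of these rows,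
would be [#|E|] times the identity and not a sign function on [G]. *)
Lemma linking_system_of_difference_matrix (gT : finGroupType)
    (G E : {group gT}) (b k : nat) : let u := 2 * b in
  abelian G -> E \subset G -> 2.-abelem%g E -> #|E| = 2 * u -> #|G| = #|E| ^ 2 ->
  1 < k -> has_difference_matrix (G / E)%G k.+1 ->
  exists L, reduced_linking_system G
    (4 * u ^ 2) (u * (2 * u - 1)) (u * (u - 1)) (u ^ 2) k L.
Proof.
move=> u cGG sEG abelE cardE cardG k_gt1 [C [phi [cardC phiQ inj_phi]]].
have nEG : G \subset 'N(E)%g by rewrite (sub_abelian_norm cGG).
have cardCE : #|C| = #|E|.
  apply/eqP; rewrite -(eqn_pmul2r (cardG_gt0 E)) cardC card_quotient //.
  by rewrite mulnC Lagrange // cardG.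
have cardC' : #|C| = #|G : E|%g by rewrite cardC card_quotient.
have u_gt0 : 0 < u by have := cardG_gt0 E; lia.
have cardG4 : #|G| = 4 * u ^ 2 by rewrite cardG cardE expnMn.
have [chi chiP] := exists_sign_characters abelE cardCE.
have [g_ gP] := lift_quotient phiQ.
have gG i c : g_ i c \in G by case: (gP i c).
have coset_quot i j c : coset E (g_ i c * (g_ j c)^-1)%g = (phi i c * (phi j c)^-1)%g.
  have NG x : x \in G -> x \in 'N(E)%g by move/(subsetP nEG).
  by rewrite -(gP i c).2 -(gP j c).2 morphM ?morphV ?groupV ?NG.
have trans_quot i j : i != j ->
    transversal_map G E (fun c => g_ i c * (g_ j c)^-1)%g.
  move=> nij; split=> [c | c c']; first by rewrite groupM ?groupV.
  by rewrite !coset_quot; apply: inj_phi.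
pose q (i : 'I_k) c := (g_ (lift ord0 i) c * (g_ ord0 c)^-1)%g.
have qG i c : q i c \in G by rewrite groupM ?groupV.
have trans_qq (i j : 'I_k) : i != j ->
    transversal_map G E (fun c => q i c * (q j c)^-1)%g.
  move=> nij; have [] := trans_quot (lift ord0 i) (lift ord0 j).
    by rewrite (inj_eq lift_inj).
  move=> hG inj_h; split=> [c | c c']; first by rewrite groupM ?groupV.
  by rewrite /q !invMg !invgK !mulgA !mulgKV; apply: inj_h.
pose f i := spread E chi (q i).
have sf i : signs_on G (f i) by apply: spread_signs => //; apply: trans_quot.
have sumf i : (\sum_y f i y = (2 * u)%:Z)%R by rewrite sum_spread // cardE.
have fM i j : (f i * zginv (f j) = spread E chi (fun c => q i c * (q j c)^-1)%g *~ #|E|)%R.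
  by rewrite (spreadM cGG sEG).
have diffset h : transversal_map G E h -> difference_set G
    (4 * u ^ 2) (u * (2 * u - 1)) (u * (u - 1)) (u ^ 2) (neg_set (spread E chi h)).
  move=> hT; apply: menon_difference_set => //.
  - exact: spread_signs.
  - by rewrite sum_spread // cardE.
  - by rewrite cardG (spread_norm cGG sEG chiP) // => c; case: hT.
have inj_D : injective (fun i => neg_set (f i)).
  move=> i j eq_neg; apply/eqP; apply: contraT => nij.
  have eq_f : f i = f j.
    apply: oppr_inj; apply: (addrI (zgset G)).
    by rewrite (zgset_neg (sf i)) eq_neg (zgset_neg (sf j)).
  have := spread_norm cGG sEG chiP (qG i); rewrite -/(f i) {2}eq_f fM => /ffunP/(_ 1%g).
  rewrite !zgmulzE zgbasisE eqxx.
  have := spread_signs cGG sEG chiP cardC' (trans_qq i j nij) 1%g.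
  rewrite group1 cardE => s1 eq1.
  by move: eq1; case: s1 => ->; nia.
exists [set neg_set (f i) | i : 'I_k]; split=> //.
- by rewrite card_imset // card_ord.
- move=> _ /imsetP[i _ ->].
  by apply: diffset; apply: trans_quot.
exists (u%:Z ^+ 2 - b%:Z - u%:Z)%R, (u%:Z ^+ 2 - b%:Z)%R.
move=> _ _ /imsetP[i _ ->] /imsetP[j _ ->] nDij.
have nij : i != j by apply: contraNneq nDij => ->.
have hT := trans_qq i j nij.
exists (neg_set (spread E chi (fun c => q i c * (q j c)^-1)%g)).
  exact: diffset.
have sh := spread_signs cGG sEG chiP cardC' hT.
rewrite (menon_linking (sf i) (sf j) sh cardG4 (sumf i) (sumf j)) ?fM ?cardE //.
by congr (_ *~ _ + _)%R; rewrite /u; lia.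
Qed.

Theorem corollary5p9 (d e : nat) (gT : finGroupType) (G : {group gT})
    (abG : abelian G) (cardG : #|G| = 2 ^ (2 * d + 2))
    (rankG : d + 1 <= 'r(G)%g) (expG : exponent G = 2 ^ e)
    (e_ge2 : 2 <= e) (e_le : 2 * e <= d + 3) :
  exists L : {set {set gT}},
    reduced_linking_system G
      (2 ^ (2 * d + 2)) (2 ^ d * (2 ^ (d + 1) - 1)) (2 ^ d * (2 ^ d - 1))
      (2 ^ (2 * d)) (2 ^ ((d + 1) %/ (e - 1)) - 1) L.
Proof.
case: e e_ge2 e_le expG => // m; rewrite ltnS => m_gt0 m_le expG.
(* [d] is positive, so that the order [2 ^ d.+2] of [E] is divisible by four. *)
case: d cardG rankG m_le => [|d] cardG rankG m_le; first lia.
have pG : 2.-group%g G by rewrite /pgroup cardG pnatX.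
have expG_dvd : exponent G %| 2 ^ m.+1 by rewrite expG.
have pO := pgroupS (Ohm_sub 1 G) pG.
have le_O : 2 ^ d.+2 <= #|'Ohm_1(G)%g|.
  rewrite (card_pgroup pO) leq_exp2l // -p_rank_abelian // -rank_pgroup //.
  by rewrite -addn1.
(* The squares form a subgroup of index [#|'Ohm_1(G)|], and the [2 ^ m]-th powers
   are among them because [0 < m]. *)
have le_M : #|'Mho^m(G)%g| <= 2 ^ d.+2.
  apply: (@leq_trans #|'Mho^1(G)%g|).
    case: m m_gt0 {m_le expG expG_dvd} => // m _.
    by rewrite -(Mho_Mho1 m pG abG) subset_leq_card ?Mho_sub.
  rewrite -(leq_pmul2l (cardG_gt0 'Ohm_1(G)%G)) mul_card_Ohm_Mho_abelian //.
  apply: leq_trans (leq_mul le_O (leqnn _)).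
  by rewrite cardG -expnD leq_exp2l //; lia.
have [|E [sEG abelE cardE expGE]] :=
  abelem_intermediate (isT : prime 2) pG abG expG_dvd (n := d.+2).
  by rewrite le_M.
have nEG : G \subset 'N(E)%g by rewrite (sub_abelian_norm abG).
have cardGE : #|(G / E)%g| = 2 ^ d.+2.
  apply/eqP; rewrite -(eqn_pmul2l (cardG_gt0 E)) card_quotient // Lagrange //.
  by rewrite cardE cardG -expnD; apply/eqP; congr (2 ^ _); lia.
rewrite [(d.+1 + 1)]addn1 subSS subn0; set r := d.+2 %/ m.
have r_gt1 : 1 < r by rewrite leq_divRL //; lia.
have dm : has_difference_matrix (G / E)%G (2 ^ r - 1).+1.
  rewrite subn1 prednK ?expn_gt0 //.
  apply: (difference_matrix_abelian_pgroup (isT : prime 2) (m := m)) => //.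
  - exact: ltnW.
  - exact: quotient_pgroup.
  - exact: quotient_abelian.
  by rewrite cardGE leq_exp2l // mulnC leq_divM.
have [|||L linkL] :=
  linking_system_of_difference_matrix (b := 2 ^ d) abG sEG abelE _ _ _ dm.
- by rewrite cardE !expnS.
- by rewrite cardG cardE -expnM; congr (2 ^ _); lia.
- have: 2 ^ 2 <= 2 ^ r by rewrite leq_exp2l.
  lia.
exists L; move: linkL; rewrite -expnS -expnS -expnM.
have -> : 4 * 2 ^ (d.+1 * 2) = 2 ^ (2 * d.+1 + 2).
  by rewrite -[4]/(2 ^ 2) -expnD; congr (2 ^ _); lia.
by rewrite [d.+1 * 2]mulnC.
Qed.
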